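(* Let $J$ be a finite set with $m:=|J|\ge3$ and let $\mathcal{Z}=(J,h,\boldsymbol g)$ be a uniform polymatroid with increment sequence $\boldsymbol g=(g_i)_{0\le i\le m}$ such that $g_0\ge g_1=g_{m-1}>0$. Then for every partition $\Pi=(P_x)_{x\in J}$ of a finite set $P$ of participants with $g_0<|P_x|$ for all $x\in J$, and every monotone increasing family $\Delta\subseteq\mathcal{P}(J)\setminus\{\emptyset\}$ compatible with $\mathcal{Z}$, the access structure $\Gamma(\Pi,\mathcal{Z},\Delta)$ is ideal.
   Context: Polymatroids. For a finite set $J$ let $\mathcal{P}(J)$ be its power set. An (integer) polymatroid is a pair $(J,h)$ with $h:\mathcal{P}(J)\to\mathbb{N}_0$ such that $h(\emptyset)=0$, $h(X)\le h(Y)$ if $X\subseteq Y$, and $h(X\cap Y)+h(X\cup Y)\le h(X)+h(Y)$. It is uniform if $h(X)=h(Y)$ whenever $|X|=|Y|$; write $h_i=h(X)$ for $|X|=i$. With $m=|J|$, its increment sequence is $\boldsymbol g=(g_0,\dots,g_m)$, $g_i=h_{i+1}-h_i$ for $0\le i\le m-1$ and $g_m=0$; it is a nonincreasing sequence of nonnegative integers, and $g_0>0$ is assumed. Such a polymatroid is written $\mathcal{Z}=(J,h,\boldsymbol g)$. Compatibility. A monotone increasing family $\Delta\subseteq\mathcal{P}(J)\setminus\{\emptyset\}$ is a nonempty family of nonempty subsets of $J$ closed under taking supersets in $J$. Fix $x_0\notin J$ and define $h'$ on $\mathcal{P}(J\cup\{x_0\})$ by $h'(X)=h(X)$ for $X\subseteq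 J$, $h'(X\cup\{x_0\})=h(X)$ if $X\in\Delta$, and $h'(X\cup\{x_0\})=h(X)+1$ if $X\subseteq J$, $X\notin\Delta$. $\Delta$ is compatible with $\mathcal{Z}$ if $h'$ is monotone increasing and submodular. Access structure. A partition $\Pi=(P_x)_{x\in J}$ of $P$ consists of pairwise disjoint nonempty sets (blocks) with union $P$. For $A\subseteq P$ put $\pi(A)=(|A\cap P_x|)_{x\in J}\in\mathbb{N}_0^J$. For $\bar v\in\mathbb{N}_0^J$ and $Y\subseteq J$ put $\mathrm{supp}(\bar v)=\{x:v_x\ne0\}$, $|\bar v|=\sum_{x\in J}v_x$, $|\bar v_Y|=\sum_{x\in Y}v_x$. For $X\subseteq J$ let $\mathcal{B}(\mathcal{Z},X)=\{\bar v\in\mathbb{N}_0^J:\mathrm{supp}(\bar v)\subseteq X,\ |\bar v|=h(X),\ |\bar v_Y|\le h(Y)\text{ for all }Y\subseteq X\}$. Then $\Gamma(\Pi,\mathcal{Z},\Delta)$ is the family of all $A\subseteq P$ such that $\pi(A)\ge\bar v$ (coordinatewise) for some $\bar v\in\bigcup_{X\in\Delta}\mathcal{B}(\mathcal{Z},X)$. Ideal access structures. A perfect secret sharing scheme with access structure $\Gamma\subseteq\mathcal{P}(P)$ consists of jointly distributed random variables $s_0$ (the secret) and $s_p$, $p\in P$ (the shares), with values in finite sets $S_0$ (with $|S_0|\ge2$) and $S_p$ respectively, every element of these sets being taken with positive probability, such that for $A\in\Gamma$ the shares $(s_p)_{p\in A}$ determine the secret $s_0$, and for $A\subseteq P$,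 $A\notin\Gamma$, the tuple $(s_p)_{p\in A}$ is independent of $s_0$ (reveals no information about the secret). The scheme is ideal if $|S_p|=|S_0|$ for all $p\in P$. The access structure $\Gamma$ is ideal if it is the access structure of some ideal perfect secret sharing scheme. *)

(* Defs.v *)
From HB Require Import structures.
From mathcomp Require Import all_boot all_order all_algebra.
From mathcomp Require Import reals.

Set Implicit Arguments.
Unset Strict Implicit.
Unset Printing Implicit Defensive.

Import Order.TTheory GRing.Theory Num.Theory.

Section Polymatroids.
Variable J : finType.
Implicit Types (h : {set J} -> nat) (g : nat -> nat) (Delta : {set {set J}}).

Definition monotone_setfun h : Prop :=
  forall X Y : {set J}, X \subset Y -> h X <= h Y.

Definition submodular h : Prop :=
  forall X Y : {set J}, h (X :&: Y) + h (X :|: Y) <= h X + h Y.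

Record polymatroid h : Prop := Polymatroid {
  polymatroid_set0 : h set0 = 0;
  polymatroid_monotone : monotone_setfun h;
  polymatroid_submodular : submodular h }.

Definition uniform_setfun h : Prop :=
  forall X Y : {set J}, #|X| = #|Y| -> h X = h Y.

(* The sequence (g_0, ..., g_m), with m = #|J|, is given by a function on nat
   whose values beyond m are irrelevant.  The subtraction h Y - h X never
   truncates, since h is uniform and monotone. *)
Definition increment_sequence h g : Prop :=
  (forall X Y : {set J}, #|Y| = #|X|.+1 -> g #|X| = h Y - h X) /\ g #|J| = 0.

Record uniform_polymatroid h g : Prop := UniformPolymatroid {
  upoly_polymatroid : polymatroid h;
  upoly_uniform : uniform_setfun h;
  upoly_increments : increment_sequence h g;
  upoly_g0_gt0 : 0 < g 0 }.

Record monotone_family Delta : Prop := MonotoneFamily {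
  mfam_neq0 : Delta != set0;
  mfam_set0 : set0 \notin Delta;
  mfam_super : forall X Y : {set J}, X \in Delta -> X \subset Y -> Y \in Delta }.

End Polymatroids.

(* The one-point extension of J by x0 is option J, with x0 = None; the trace
   of X : {set option J} on J is Some @^-1: X. *)
Definition one_point_extension (J : finType) (h : {set J} -> nat)
    (Delta : {set {set J}}) (X : {set option J}) : nat :=
  let Y := Some @^-1: X in
  if (None \in X) && (Y \notin Delta) then h Y + 1 else h Y.

Definition compatible_family (J : finType) (h : {set J} -> nat)
    (Delta : {set {set J}}) : Prop :=
  monotone_setfun (one_point_extension h Delta) /\
  submodular (one_point_extension h Delta).

Section AccessStructures.
Variables J P : finType.
Implicit Types (Pi : J -> {set P}) (h : {set J} -> nat).

Record block_partition Pi : Prop := BlockPartition {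
  ipart_disjoint : forall x y, x != y -> [disjoint Pi x & Pi y];
  ipart_neq0 : forall x, Pi x != set0;
  ipart_cover : \bigcup_(x : J) Pi x = [set: P] }.

Definition block_profile Pi (A : {set P}) : {ffun J -> nat} :=
  [ffun x => #|A :&: Pi x|].

Definition polymatroid_bases h (X : {set J}) (v : {ffun J -> nat}) : Prop :=
  [/\ [set x | v x != 0] \subset X,
      \sum_(x : J) v x = h X
    & forall Y : {set J}, Y \subset X -> \sum_(x in Y) v x <= h Y].

Definition access_structure Pi h (Delta : {set {set J}}) (A : {set P}) : Prop :=
  exists v : {ffun J -> nat},
    (exists2 X, X \in Delta & polymatroid_bases h X v) /\
    (forall x, v x <= block_profile Pi A x).

End AccessStructures.

Local Open Scope ring_scope.

(* The random variables are functions on a common finite probability space;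
   this loses no generality, all of them being finitely valued. *)
Record sharing_scheme (R : realType) (P : finType) := SharingScheme {
  outcome : finType;
  mass : outcome -> R;
  mass_ge0 : forall w, 0 <= mass w;
  mass_sum1 : \sum_w mass w = 1;
  secretT : finType;
  shareT : P -> finType;
  secret : outcome -> secretT;
  share : forall p : P, outcome -> shareT p }.

Section Schemes.
Variables (R : realType) (P : finType) (S : sharing_scheme R P).

Definition Prob (E : pred (outcome S)) : R := \sum_(w | E w) mass w.

Definition shares_eq (A : {set P}) (b : forall p : P, shareT S p)
    (w : outcome S) : bool :=
  [forall p in A, share p w == b p].

Definition determining_shares (A : {set P}) : Prop :=
  forall w w' : outcome S, 0 < mass w -> 0 < mass w' ->
    (forall p, p \in A -> share p w = share p w') -> secret w = secret w'.

Definition independent_shares (A : {set P}) : Prop :=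
  forall (a : secretT S) (b : forall p : P, shareT S p),
    Prob (fun w => (secret w == a) && shares_eq A b w) =
    Prob (fun w => secret w == a) * Prob (shares_eq A b).

Record perfect_scheme (Gamma : {set P} -> Prop) : Prop := PerfectScheme {
  perfect_secret_card : (2 <= #|secretT S|)%N;
  perfect_secret_gt0 : forall a : secretT S, 0 < Prob (fun w => secret w == a);
  perfect_share_gt0 : forall (p : P) (b : shareT S p),
    0 < Prob (fun w => share p w == b);
  perfect_determines : forall A, Gamma A -> determining_shares A;
  perfect_independent : forall A, ~ Gamma A -> independent_shares A }.

Definition ideal_scheme : Prop := forall p : P, #|shareT S p| = #|secretT S|.

End Schemes.

Definition ideal_access_structure (R : realType) (P : finType)
    (Gamma : {set P} -> Prop) : Prop :=
  exists S : sharing_scheme R P, perfect_scheme S Gamma /\ ideal_scheme S.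

(* Main.v *)
(** With [a = g 0] and [b = g 1], monotonicity of the increments gives
    [h X = a + b (|X| - 1)] for [X] nonempty.  Submodularity of the one-point
    extension makes [Delta] closed under intersections that are nonempty (or
    arbitrary, if [a = b]), so [Delta] either consists of all supersets of some
    [S], or [b < a] and [Delta] consists of all nonempty sets.  The extended
    polymatroid is then represented by coordinate subspaces
    [V_x = W (+) E_x], with [dim W = a - b] and [dim E_x = b], and a 0/1 vector
    [s]: the sum of one basis vector of each [E_x], [x] in [S], or a basis
    vector of [W].  Over a large prime field, choosing the vector of each
    participant freely in the space of its block gives vectors whose spans have
    the rank [min_Y (h Y + |A \ P_Y|)], even after adding [s]; hence [s] is
    spanned by the participants of [A] exactly when [A] is authorised.  The
    scheme draws a uniform linear form and evaluates it at these vectors. *)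

Require Import Defs.
From mathcomp Require Import all_boot all_order all_algebra.
From mathcomp Require Import reals.
From mathcomp Require Import all_field.
From mathcomp Require Import zify.

Set Implicit Arguments.
Unset Strict Implicit.
Unset Printing Implicit Defensive.

Import Order.TTheory GRing.Theory Num.Theory.

Lemma exists_set_card (T : finType) k :
  k <= #|T| -> exists A : {set T}, #|A| = k.
Proof.
move=> lekT; exists [set x in take k (enum T)].
by rewrite cardsE (card_uniqP _) ?take_uniq ?enum_uniq // size_takel // -cardE.
Qed.

(** * Rank values of a uniform polymatroid with flat increments *)

Section UniformPolymatroids.

Variables (J : finType) (h : {set J} -> nat) (g : nat -> nat).
Hypothesis hZ : uniform_polymatroid h g.

Lemma uniform_setU1 (X : {set J}) x :
  x \notin X -> h (x |: X) = h X + g #|X|.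
Proof.
have [_ mono _] := upoly_polymatroid hZ; have [gE _] := upoly_increments hZ.
move=> xX; rewrite (gE X (x |: X)) ?cardsU1 ?xX // subnKC //.
exact/mono/subsetUr.
Qed.

(** Submodularity is applied to [x |: X] and [y |: X] for a set [X] of size [i] and two distinct
    points outside it, which exist because [i.+1 < #|J|]. *)
Lemma increments_noninc i : i.+1 < #|J| -> g i.+1 <= g i.
Proof.
move=> ltiJ; have [|X cX] := @exists_set_card J i; first by lia.
have /card_gt1P[x [y [xX yX xy]]] : 1 < #|~: X| by rewrite cardsCs setCK; lia.
rewrite !inE in xX yX; have [_ _ subm] := upoly_polymatroid hZ.
have yxX : y \notin x |: X by rewrite !inE eq_sym negb_or xy.
have := subm (x |: X) (y |: X).
have -> : (x |: X) :&: (y |: X) = X.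
  apply/setP=> z; rewrite !inE; case: (z =P x) => [->|_] /=.
    by rewrite (negPf xy) (negPf xX).
  by case: (z =P y) => [->|_] /=; rewrite ?(negPf yX) ?andbb.
have -> : (x |: X) :|: (y |: X) = y |: (x |: X).
  apply/setP=> z; rewrite !inE.
  by case: (z == x); case: (z == y); case: (z \in X).
by rewrite !uniform_setU1 // cardsU1 xX cX add1n; lia.
Qed.

Lemma increments_anti i j : i <= j < #|J| -> g j <= g i.
Proof.
case/andP=> /subnKC <-; elim: (j - i) => [|d IHd] lt_d; first by rewrite addn0.
rewrite addnS in lt_d *.
exact: leq_trans (increments_noninc lt_d) (IHd (ltnW lt_d)).
Qed.

(** Every increment with index from 1 to [#|J|.-1] is squeezed between [g 1] and [g #|J|.-1], so
    each point after the first adds exactly [g 1]. *)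
Lemma uniform_flat_increments (X : {set J}) :
  g 1 = g #|J|.-1 -> X != set0 -> h X = g 0 + g 1 * #|X|.-1.
Proof.
move=> g1; move cX: #|X| => k; case: k cX => [|k] cX.
  by rewrite (cards0_eq cX) eqxx.
move=> _; elim: k => [|k IHk] /= in X cX *.
  have /cards1P[x ->] : #|X| == 1 by rewrite cX.
  rewrite muln0 addn0 -(setU0 [set x]) uniform_setU1 ?inE // cards0.
  by rewrite (polymatroid_set0 (upoly_polymatroid hZ)).
have [x xX] : exists x, x \in X by apply/card_gt0P; rewrite cX.
have cX1 : #|X :\ x| = k.+1 by move: cX; rewrite (cardsD1 x X) xX => -[].
rewrite -(setD1K xX) uniform_setU1 ?setD11 // IHk // cX1.
have ltk : k.+1 < #|J| by rewrite -cX max_card.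
have : g k.+1 = g 1.
  apply/eqP; rewrite eqn_leq increments_anti ?ltk //= g1.
  by apply: increments_anti; lia.
by move=> ->; rewrite mulnS; lia.
Qed.

End UniformPolymatroids.

(** * Classification of the compatible families and their coordinate model *)

Section CompatibleFamilies.

Variables (J : finType) (h : {set J} -> nat) (Delta : {set {set J}}).
Hypothesis hD : monotone_family Delta.
Hypothesis hcomp : compatible_family h Delta.

(** Add the extra point to both sets. If [X :&: Y] were not in [Delta], the extension would exceed
    [h] by one on the intersection and agree with [h] on the other three sets, against
    submodularity. *)
Lemma compatible_setI (X Y : {set J}) : X \in Delta -> Y \in Delta ->
  h X + h Y <= h (X :&: Y) + h (X :|: Y) -> X :&: Y \in Delta.
Proof.
move=> XD YD hXY; apply: contraT => XYD.
have [_ /(_ (None |: Some @: X) (None |: Some @: Y))] := hcomp.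
have pre (Z : {set J}) : Some @^-1: (None |: Some @: Z) = Z.
  apply/setP=> z; rewrite !inE /=; apply/imsetP/idP => [[z' z'Z [->]] //|zZ].
  by exists z.
have preI : Some @^-1: ((None |: Some @: X) :&: (None |: Some @: Y)) = X :&: Y.
  by rewrite preimsetI !pre.
have preU : Some @^-1: ((None |: Some @: X) :|: (None |: Some @: Y)) = X :|: Y.
  by rewrite preimsetU !pre.
have XYUD := mfam_super hD XD (subsetUl X Y).
rewrite /one_point_extension preI preU !pre !inE eqxx /= XD YD XYUD XYD /=.
lia.
Qed.

Lemma compatible_family_cases a b :
    h set0 = 0 -> (forall X, X != set0 -> h X = a + b * #|X|.-1) -> b <= a ->
  (exists2 S, S != set0 & forall X, (X \in Delta) = (S \subset X)) \/
  (b < a /\ forall X, (X \in Delta) = (X != set0)).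
Proof.
move=> h0 hE leba.
(* The pair is modular for [h]: the formula in [hE] is affine in the cardinality, and for [a = b] it
   also holds at the empty set. *)
have mod X Y : X \in Delta -> Y \in Delta -> (X :&: Y != set0) || (a == b) ->
    X :&: Y \in Delta.
  move=> XD YD cond; apply: compatible_setI => //.
  have neq0 Z : Z \in Delta -> Z != set0.
    by apply: contraTneq => ->; exact: mfam_set0 hD.
  have U0 := neq0 _ (mfam_super hD XD (subsetUl X Y)).
  rewrite (hE X) ?neq0 // (hE Y) ?neq0 // (hE _ U0); have := cardsUI X Y.
  move: (neq0 _ XD) (neq0 _ YD) U0; rewrite -!card_gt0.
  case: (altP (X :&: Y =P set0)) cond => [-> /= /eqP <-|+ _].
    rewrite h0 cards0 addn0 add0n => X0 Y0 U0 cU.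
    by rewrite -!mulnS !prednK // -mulnDr leq_mul2l; lia.
  move=> I0; rewrite (hE _ I0); move: I0; rewrite -card_gt0 => I0 X0 Y0 U0 cU.
  by rewrite addnACA [leqRHS]addnACA leq_add2l -!mulnDr leq_mul2l; lia.
(* Either the inclusion-minimal member [S] lies in every member, or some member [Y] does not contain
   it; minimality and [mod] then force [S] and [Y] to be disjoint, and every singleton is shown to
   be a member. *)
have [S /minsetP[/= SD Smin]] : {S | minset [pred X | X \in Delta] S}.
  by apply: ex_minset; apply/set0Pn; exact: mfam_neq0 hD.
have S0 : S != set0 by apply: contraTneq SD => ->; exact: mfam_set0 hD.
case: (boolP [forall X in Delta, S \subset X]) => [/forall_inP subS|].
  left; exists S => // X; apply/idP/idP => [/subS //|].
  exact: (mfam_super hD SD).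
case/forall_inPn=> Y YD nSY; right.
have SY : S :&: Y \notin Delta.
  apply: contra nSY => /Smin/(_ (subsetIl _ _)) => eqS.
  by rewrite -eqS subsetIr.
have dSY : S :&: Y = set0.
  by apply/eqP; apply: contraNT SY => SY0; apply: mod; rewrite ?SY0.
split.
  rewrite ltn_neqAle leba andbT; apply: contra SY => /eqP eqab.
  by apply: mod; rewrite ?eqab ?eqxx ?orbT.
have Y1 y : y \in Y -> [set y] \in Delta.
  move=> yY; have yS : y \notin S.
    by apply/negP=> yS; have := in_set0 y; rewrite -dSY inE yS yY.
  have -> : [set y] = (y |: S) :&: Y.
    by rewrite setIUl dSY setU0; apply/esym/setIidPl; rewrite sub1set.
  apply: mod => //; first exact: (mfam_super hD SD (subsetUr _ _)).
  by apply/orP; left; apply/set0Pn; exists y; rewrite !inE eqxx.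
have [y yY] : exists y, y \in Y.
  by apply/set0Pn; apply: contraTneq YD => ->; exact: mfam_set0 hD.
have yS : y \notin S.
  by apply/negP=> yS; have := in_set0 y; rewrite -dSY inE yS yY.
(* A fixed [y] in [Y] lies outside [S], so enlarging [S] and [[set y]] by [z] gives two members that
   meet exactly in [z]. *)
have D1 z : [set z] \in Delta.
  have -> : [set z] = (z |: S) :&: (z |: [set y]).
    rewrite -setUIr [S :&: _](_ : _ = set0) ?setU0 //.
    by apply/setP=> u; rewrite !inE; case: (u =P y) => [->|_];
       rewrite ?andbF ?(negPf yS).
  apply: mod; first exact: (mfam_super hD SD (subsetUr _ _)).
    exact: (mfam_super hD (Y1 y yY) (subsetUr _ _)).
  by apply/orP; left; apply/set0Pn; exists z; rewrite !inE eqxx.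
move=> X; apply/idP/idP => [|/set0Pn[x xX]].
  by apply: contraTneq => ->; exact: mfam_set0 hD.
by apply: (mfam_super hD (D1 x)); rewrite sub1set.
Qed.

(** [K X] indexes a basis of the space of [X]: for [X] nonempty it has [(a - b) + b * #|X|]
    elements, which is [a + b * #|X|.-1]. [T] is the support of the secret vector. *)
Lemma coordinate_representation a b :
    h set0 = 0 -> (forall X, X != set0 -> h X = a + b * #|X|.-1) ->
    0 < b <= a ->
  exists (I : finType) (K : {set J} -> {set I}) (T : {set I}),
    [/\ forall X, #|K X| = h X, forall X Y, K (X :|: Y) = K X :|: K Y
      & forall X, (T \subset K X) = (X \in Delta)].
Proof.
move=> h0 hE /andP[b0 leba].
pose I : finType := ('I_(a - b) + J * 'I_b)%type.
pose K (X : {set J}) : {set I} :=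
  [set i | match i with inl _ => X != set0 | inr (x, _) => x \in X end].
have cK X : #|K X| = h X.
  have [->|X0] := eqVneq X set0.
    rewrite h0; apply/eqP; rewrite cards_eq0; apply/eqP/setP=> -[i|[x j]];
      by rewrite !inE ?eqxx.
  have -> : K X = inl @: [set: 'I_(a - b)] :|: inr @: setX X [set: 'I_b].
    apply/setP=> -[i|[x j]]; rewrite !inE.
      by rewrite X0 imset_f ?inE.
    rewrite [X in X || _](negbTE _) /=; last by apply/imsetP=> -[].
    by rewrite mem_imset ?inE ?andbT // => u v [].
  rewrite cardsU [_ :&: _](_ : _ = set0) ?cards0 ?subn0; last first.
    apply/setP=> -[i|i]; rewrite !inE; apply/negbTE/nandP.
      by right; apply/imsetP=> -[].
    by left; apply/imsetP=> -[].
  rewrite !card_imset; try by move=> u v [].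
  rewrite cardsX !cardsT !card_ord hE //.
  by move: X0; rewrite -card_gt0; nia.
have KU X Y : K (X :|: Y) = K X :|: K Y.
  apply/setP=> -[i|[x j]]; rewrite !inE //.
  by rewrite -negb_and setU_eq0.
exists I, K.
have [[S S0 DE]|[ltba DE]] := compatible_family_cases h0 hE leba.
  exists [set inr (x, Ordinal b0) | x in S]; split=> // X; rewrite DE.
  apply/subsetP/subsetP => [sub x xS|sub _ /imsetP[x xS ->]].
    by have := sub _ (imset_f _ xS); rewrite inE.
  by rewrite inE sub.
have c0 : 0 < a - b by rewrite subn_gt0.
by exists [set inl (Ordinal c0)]; split=> // X; rewrite DE sub1set inE.
Qed.

End CompatibleFamilies.

(** * Dimensions of sums of subspaces *)

Section VectorSpaces.

Variables (K : fieldType) (vT : vectType K).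

Lemma dim_addv_le (U W : {vspace vT}) : \dim (U + W) <= \dim U + \dim W.
Proof. exact: dimv_add_leqif. Qed.

Lemma dim_add_vline (u : vT) (W : {vspace vT}) :
  u \notin W -> \dim (<[u]> + W) = (\dim W).+1.
Proof.
move=> uW; rewrite dimv_disjoint_sum.
  by rewrite dim_vline; case: eqP uW => // ->; rewrite mem0v.
apply/eqP; rewrite -subv0; apply/subvP=> _ /memv_capP[/vlineP[c ->]].
have [->|c0] := eqVneq c 0%R; first by rewrite scale0r !mem0v.
by rewrite rpredZeq (negPf uW) (negPf c0).
Qed.

End VectorSpaces.



(** * Generic vectors over a large finite field and their rank *)

Section GenericVectors.

Local Open Scope ring_scope.
Variables (F : finFieldType) (n : nat).
Local Notation vT := 'rV[F]_n.

(** Counting: each [U i] not containing [W] meets it in at most [#|F| ^ (\dim W).-1] vectors, so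
    fewer than [#|F|] of them cannot cover [W]. *)
Lemma avoid_subspaces (I : finType) (U : I -> {vspace vT}) (W : {vspace vT}) :
  (#|I| < #|F|)%N ->
  exists2 w, w \in W & forall i, w \in U i -> (W <= U i)%VS.
Proof.
move=> ltIF; pose bad := [pred w | [exists i, (w \in U i) && ~~ (W <= U i)%VS]].
case: (pickP [pred w in W | ~~ bad w]) => [w /andP[wW nbad]|allbad].
  exists w => // i wU; apply: contraNT nbad => nWU.
  by apply/existsP; exists i; rewrite wU.
(* The zero vector is bad for some [U i], which excludes [W = 0] and makes the predecessor of the
   dimension genuine. *)
have W0 : (0 < \dim W)%N.
  have := allbad 0; rewrite /= mem0v /= => /negbFE/existsP[i /andP[_]].
  by rewrite lt0n dimv_eq0; apply: contraNneq => ->; exact: sub0v.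
have: (#|W| <= \sum_(i : I) #|F| ^ (\dim W).-1)%N.
  pose C i := [set w in (W :&: U i)%VS].
  apply: (@leq_trans #|\bigcup_(i | ~~ (W <= U i)%VS) C i|).
    apply/subset_leq_card/subsetP => w wW.
    have /= := allbad w; rewrite wW /= => /negbFE/existsP[i /andP[wU nWU]].
    by apply/bigcupP; exists i => //; rewrite inE memv_cap wW.
  apply: (@leq_trans (\sum_(i | ~~ (W <= U i)%VS) #|C i|)%N).
    elim/big_rec2: _ => [|i k A _ IH]; first by rewrite cards0.
    by rewrite (leq_trans (leq_card_setU _ _)) // leq_add2l.
  rewrite big_mkcond leq_sum // => i _; case: ifP => // nWU.
  rewrite cardsE card_vspace leq_exp2l ?finNzRing_gt1 // -ltnS prednK //.
  rewrite ltn_neqAle dimvS ?capvSl // andbT.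
  apply: contra nWU; rewrite (dimv_leqif_eq (capvSl W (U i))) => /eqP <-.
  exact: capvSr.
rewrite card_vspace sum_nat_const -{1}(prednK W0) expnS leq_pmul2r.
  by rewrite leqNgt ltIF.
by rewrite expn_gt0 (ltnW (finNzRing_gt1 F)).
Qed.

Variables (J P : finType) (blk : P -> J) (V : {set J} -> {vspace vT}).
Hypothesis VU : forall X Y, V (X :|: Y) = (V X + V Y)%VS.
Implicit Types (w : P -> vT) (A B : {set P}) (Y Z : {set J}).

Definition spanned w B : {vspace vT} := (\sum_(p in B) <[w p]>)%VS.

Lemma spannedS w A B : A \subset B -> (spanned w A <= spanned w B)%VS.
Proof.
move=> sAB; apply/subv_sumP=> p pA.
exact: (sumv_sup p (subsetP sAB _ pA)).
Qed.

Lemma spannedU1 w p B :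
  p \notin B -> spanned w (p |: B) = (<[w p]> + spanned w B)%VS.
Proof. exact: big_setU1. Qed.

Lemma spannedU w A B : (spanned w (A :|: B) <= spanned w A + spanned w B)%VS.
Proof.
apply/subv_sumP=> p; rewrite inE => /orP[pA|pB].
  exact: subv_trans (sumv_sup p pA (subvv _)) (addvSl _ _).
exact: subv_trans (sumv_sup p pB (subvv _)) (addvSr _ _).
Qed.

Lemma eq_spanned w w' B : {in B, w =1 w'} -> spanned w B = spanned w' B.
Proof. by move=> eqw; apply: eq_bigr => p /eqw->. Qed.

Lemma dim_spanned w B : (\dim (spanned w B) <= #|B|)%N.
Proof.
rewrite -sum1_card /spanned.
elim/big_rec2: _ => [|p k W _ IH]; first by rewrite dimv0.
rewrite (leq_trans (dim_addv_le _ _)) // leq_add // dim_vline.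
by case: eqP.
Qed.

Lemma exists_independent w A :
  exists B, [/\ B \subset A, spanned w B = spanned w A
              & \dim (spanned w B) = #|B|].
Proof.
move cA: #|A| => k; elim: k => [|k IHk] in A cA *.
  exists A; split=> //; rewrite (cards0_eq cA) /spanned big_set0 dimv0.
  by rewrite cards0.
have [p pA] : exists p, p \in A by apply/card_gt0P; rewrite cA.
have [|B [sBA spB dB]] := IHk (A :\ p).
  by move: cA; rewrite (cardsD1 p) pA => -[].
have pB : p \notin B by apply/negP=> /(subsetP sBA); rewrite !inE eqxx.
have eqA : spanned w A = (<[w p]> + spanned w B)%VS.
  by rewrite -{1}(setD1K pA) spannedU1 ?setD11 // spB.
case: (boolP (w p \in spanned w B)) => wpB.
  exists B; split=> //; first exact: subset_trans sBA (subsetDl _ _).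
  by rewrite eqA; apply/esym/addv_idPr; rewrite -memvE.
exists (p |: B); split; last 1 first.
- by rewrite spannedU1 // dim_add_vline // dB cardsU1 pB.
- rewrite subUset sub1set pA; exact: subset_trans sBA (subsetDl _ _).
- by rewrite spannedU1.
Qed.

Variables (I : finType) (U : I -> {vspace vT}).

(* The head of the list is chosen after its tail, and lies in the listed
   subspaces only when its whole block space does. *)
Fixpoint generic w (r : seq P) : Prop :=
  if r is p :: r' then
    [/\ w p \in V [set blk p],
        forall i Z B, {subset B <= r'} ->
          w p \in (U i + V Z + spanned w B)%VS ->
          (V [set blk p] <= U i + V Z + spanned w B)%VS
      & generic w r']
  else True.

Lemma eq_generic w w' r : {in r, w =1 w'} -> generic w r -> generic w' r.
Proof.
elim: r => //= p r IHr eqw [wV wG Gr].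
have eqr : {in r, w =1 w'} by move=> q qr; rewrite eqw // inE qr orbT.
split; [by rewrite -eqw // inE eqxx| |exact: IHr].
move=> i Z B sBr.
rewrite -eqw ?inE ?eqxx // -(@eq_spanned w); first exact: wG.
by move=> q /sBr; exact: eqr.
Qed.

(** Each choice must avoid one subspace per triple [(i, Z, B)], so a field with more elements than
    there are triples suffices at every stage. *)
Lemma exists_generic r :
  (#|{: I * {set J} * {set P}}| < #|F|)%N -> uniq r -> exists w, generic w r.
Proof.
move=> ltF; elim: r => [|p r IHr] /=; first by exists (fun=> 0).
case/andP=> pr /IHr[w Gw].
have [u uV uG] := @avoid_subspaces _
  (fun t : I * {set J} * {set P} => (U t.1.1 + V t.1.2 + spanned w t.2)%VS)
  (V [set blk p]) ltF.
pose w' q := if q == p then u else w q.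
have eqw : {in r, w =1 w'}.
  by move=> q qr; rewrite /w'; case: eqP => // qp; rewrite -qp qr in pr.
exists w'; split; first by rewrite /w' eqxx.
  move=> i Z B sBr; rewrite -(@eq_spanned w); last by move=> q /sBr; exact: eqw.
  by rewrite {1}/w' eqxx => /(uG (i, Z, B)).
exact: eq_generic Gw.
Qed.

Definition blocks Y : {set P} := [set p | blk p \in Y].

(* If [w p] lies in the space already spanned, then by genericity so does the
   whole space of its block, and that block can be moved into [Z]. *)
Lemma generic_rank w r i Z B : generic w r -> {subset B <= r} ->
  exists2 Y : {set J}, Z \subset Y &
    (\dim (U i + V Y) + #|B :\: blocks Y|
       <= \dim (U i + V Z + spanned w B))%N.
Proof.
elim: r Z B => [|p r IHr] Z B /=; [move=> _|case=> wV wG Gr] => sBr.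
  have -> : B = set0 by apply/setP=> q; rewrite inE; apply/negP=> /sBr.
  by exists Z; rewrite // set0D cards0 addn0 /spanned big_set0 addv0.
have [pB|pB] := boolP (p \in B); last first.
  apply: IHr => // q qB; have := sBr q qB; rewrite inE => /orP[/eqP qp|//].
  by rewrite -qp qB in pB.
have sB'r : {subset B :\ p <= r}.
  by move=> q; rewrite !inE => /andP[qp /sBr]; rewrite inE (negPf qp).
rewrite -(setD1K pB) spannedU1 ?setD11 //.
set B' := B :\ p in sB'r *.
have eqS : (U i + V Z + (<[w p]> + spanned w B')
            = <[w p]> + (U i + V Z + spanned w B'))%VS.
  by rewrite addvA [(_ + <[_]>)%VS]addvC -addvA.
have [wp|wp] := boolP (w p \in (U i + V Z + spanned w B')%VS).
  have [Y sY leY] := IHr (blk p |: Z) B' Gr sB'r.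
  have pY : blk p \in Y by apply: (subsetP sY); rewrite !inE eqxx.
  exists Y; first exact: subset_trans (subsetUr _ _) sY.
  have -> : (p |: B') :\: blocks Y = B' :\: blocks Y.
    by rewrite setDUl [X in X :|: _](_ : _ = set0) ?set0U //;
       apply/setP=> q; rewrite !inE; case: eqP => [->|]; rewrite ?pY ?andbF.
  apply: leq_trans leY _; apply: dimvS; rewrite VU.
  apply: subv_trans (_ : _ <= U i + V Z + spanned w B')%VS _.
    rewrite !subv_add wG // addvSr andbT.
    by rewrite (subv_trans (addvSl _ _) (addvSl _ _))
               (subv_trans (addvSr _ _) (addvSl _ _)).
  by rewrite eqS addvSr.
(* Here [w p] raises the dimension by one, which pays for the at most one element that [p] adds to
   [B' :\: blocks Y]. *)
have [Y sY leY] := IHr Z B' Gr sB'r.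
exists Y => //; rewrite eqS dim_add_vline //.
apply: leq_trans (leY : _.+1 <= _.+1)%N; rewrite -addnS.
rewrite leq_add2l setDUl (leq_trans (leq_card_setU _ _)) // -add1n leq_add2r.
by rewrite (leq_trans (subset_leq_card (subsetDl _ _))) ?cards1.
Qed.

Lemma generic_mem w r p : generic w r -> p \in r -> w p \in V [set blk p].
Proof.
elim: r => //= q r IHr [wV _ Gr]; rewrite inE => /orP[/eqP->//|]; exact: IHr.
Qed.

End GenericVectors.

(** * The linear scheme and its perfectness *)

Section LinearScheme.

Local Open Scope ring_scope.
Variables (R : realType) (F : finFieldType) (n : nat) (P : finType).
Variables (s : 'rV[F]_n) (w : P -> 'rV[F]_n).

Definition pairing (v : 'rV[F]_n) (u : 'cV[F]_n) : F := (v *m u) 0 0.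

Lemma pairingDr v u u' : pairing v (u + u') = pairing v u + pairing v u'.
Proof. by rewrite /pairing mulmxDr mxE. Qed.

Lemma pairingZr c v u : pairing v (c *: u) = c * pairing v u.
Proof. by rewrite /pairing -scalemxAr mxE. Qed.

Lemma pairing_spanned (A : {set P}) v u :
  v \in spanned w A -> (forall p, p \in A -> pairing (w p) u = 0) ->
  pairing v u = 0.
Proof.
case/memv_sumP=> vs vsA -> u0; rewrite /pairing mulmx_suml summxE big1 // => p pA.
have /vlineP[c ->] := vsA p pA.
by rewrite -scalemxAl mxE [X in _ * X](u0 p pA) mulr0.
Qed.

(** Some column of the cokernel of the matrix with rows [w p], [p] in [A], pairs nontrivially with
    [v]; it is rescaled to pair to 1. *)
Lemma separating_covector (A : {set P}) v : v \notin spanned w A ->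
  exists2 u, pairing v u = 1 & forall p, p \in A -> pairing (w p) u = 0.
Proof.
move=> vA; pose M : 'M[F]_(#|A|, n) := \matrix_(i < #|A|) w (enum_val i).
have: ~~ (v <= M)%MS.
  apply: contra vA => /submxP[D ->]; rewrite mulmx_sum_row memv_suml // => i _.
  rewrite rowK memvZ //; apply: (subvP (sumv_sup _ (enum_valP i) (subvv _))).
  exact: memv_line.
rewrite submxE => /eqP/rowP/eqfunP; rewrite negb_forall => /existsP[j].
rewrite [X in _ == X]mxE => c0; pose c := (v *m cokermx M) 0 j.
exists (c^-1 *: col j (cokermx M)) => [|p pA].
  by rewrite pairingZr /pairing colE mulmxA -colE mxE mulVf.
rewrite pairingZr /pairing colE mulmxA -colE.
have -> : w p = row (enum_rank_in pA p) M by rewrite rowK enum_rankK_in.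
by rewrite -row_mul mulmx_coker row0 !mxE mulr0.
Qed.

(** Translation by [(b' - b) *: u] preserves [C] and injects the fibre over [b] into the one over
    [b'], so all [#|F|] fibres have the same size. *)
Lemma card_fiber (C : pred 'cV[F]_n) v u a :
    pairing v u = 1 -> (forall c t, C (t + c *: u) = C t) ->
  (#|[pred t | (pairing v t == a) && C t]| * #|F| = #|C|)%N.
Proof.
move=> vu Cu; pose N b := #|[pred t | (pairing v t == b) && C t]|.
have leN b b' : (N b <= N b')%N.
  pose f t : 'cV[F]_n := t + (b' - b) *: u.
  rewrite /N -(card_image (addIr _ : injective f)).
  apply/subset_leq_card/subsetP=> _ /imageP[t + ->]; rewrite !inE Cu.
  case/andP=> /eqP tb ->; rewrite pairingDr pairingZr vu tb mulr1.
  by rewrite addrC subrK eqxx.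
rewrite -[RHS]sum1_card (partition_big (pairing v) predT) //=.
rewrite (eq_bigr (fun=> N a)) => [|b _]; first by rewrite sum_nat_const mulnC.
rewrite sum1_card; apply/eqP; rewrite eqn_leq.
have -> : #|[pred t | C t & pairing v t == b]| = N b.
  by apply: eq_card => t; rewrite !inE andbC.
by rewrite !leN.
Qed.

Let weight : R := #|'cV[F]_n|%:R^-1.

Lemma uniform_weight_ge0 (u : 'cV[F]_n) : 0 <= weight.
Proof. by rewrite invr_ge0 ler0n. Qed.

Lemma uniform_weight_sum : \sum_(u : 'cV[F]_n) weight = 1.
Proof.
rewrite sumr_const -[RHS](@mulVf _ #|'cV[F]_n|%:R) ?mulr_natr //.
by rewrite pnatr_eq0 -lt0n; apply/card_gt0P; exists 0.
Qed.

Definition linear_scheme : sharing_scheme R P :=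
  @SharingScheme R P 'cV[F]_n (fun=> weight) uniform_weight_ge0
    uniform_weight_sum F (fun=> F) (pairing s) (fun p => pairing (w p)).

Lemma linear_scheme_Prob (E : pred 'cV[F]_n) :
  Prob (S := linear_scheme) E = #|E|%:R * weight.
Proof. by rewrite /Prob /= sumr_const mulr_natl. Qed.

Lemma linear_scheme_fiber_Prob (C : pred 'cV[F]_n) v u a :
    pairing v u = 1 -> (forall c t, C (t + c *: u) = C t) ->
  Prob (S := linear_scheme) (fun t => (pairing v t == a) && C t) =
  #|F|%:R^-1 * Prob (S := linear_scheme) C.
Proof.
move=> vu Cu; rewrite !linear_scheme_Prob -(card_fiber a vu Cu) natrM.
rewrite mulrA; congr (_ * _); rewrite mulrC mulfK //.
by rewrite pnatr_eq0 -lt0n; apply/card_gt0P; exists 0.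
Qed.

Lemma linear_scheme_value_Prob v a :
  v != 0 -> Prob (S := linear_scheme) (fun t => pairing v t == a) = #|F|%:R^-1.
Proof.
move=> v0; have [|u vu _] := @separating_covector set0 v.
  by rewrite /spanned big_set0 memv0.
have <- : Prob (S := linear_scheme) (fun t => (pairing v t == a) && xpredT t) =
          Prob (S := linear_scheme) (fun t => pairing v t == a).
  by rewrite !linear_scheme_Prob; congr (_%:R * _); apply: eq_card => t;
     rewrite !unfold_in /= andbT.
rewrite (linear_scheme_fiber_Prob _ vu) // /Prob /= uniform_weight_sum.
by rewrite mulr1.
Qed.

Lemma linear_scheme_perfect (Gamma : {set P} -> Prop) :
    s != 0 -> (forall p, w p != 0) ->
    (forall A, Gamma A <-> s \in spanned w A) ->
  perfect_scheme linear_scheme Gamma.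
Proof.
move=> s0 w0 GE.
have F_gt0 : 0 < #|F|%:R^-1 :> R.
  by rewrite invr_gt0 ltr0n; apply/card_gt0P; exists 0.
split.
- exact: finNzRing_gt1.
- by move=> a; rewrite linear_scheme_value_Prob.
- by move=> p b; rewrite linear_scheme_value_Prob.
(* By linearity, the difference of two outcomes with equal shares on [A] pairs to zero with the span
   of these vectors, hence with [s]. *)
- move=> A /GE sA u u' _ _ /= eqA; apply/eqP; rewrite -subr_eq0 -mulN1r.
  rewrite -pairingZr -pairingDr; apply/eqP/(pairing_spanned sA) => p pA.
  by rewrite pairingDr pairingZr mulN1r eqA // subrr.
move=> A nGA a b.
(* Translating along [u] fixes all shares of [A] and runs the secret through every value. *)
have /separating_covector[u su uA] : s \notin spanned w A.
  by apply/negP=> /GE.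
rewrite /= (linear_scheme_value_Prob _ s0).
apply: (linear_scheme_fiber_Prob _ su) => c t.
apply: eq_forallb => p; case: (boolP (p \in A)) => //= pA.
by rewrite pairingDr pairingZr uA // mulr0 addr0.
Qed.

End LinearScheme.

(** * Spanning the secret vector and authorised sets *)

Section AccessStructure.

Variables (F : finFieldType) (n : nat) (J P : finType) (blk : P -> J).
Variables (h : {set J} -> nat) (Delta : {set {set J}}).
Variables (V : {set J} -> {vspace 'rV[F]_n}) (s : 'rV[F]_n) (w : P -> 'rV[F]_n).
Hypothesis hP : polymatroid h.
Hypothesis VU : forall X Y, V (X :|: Y) = (V X + V Y)%VS.
Hypothesis dimV : forall X, \dim (V X) = h X.
Hypothesis sV : forall X, (s \in V X) = (X \in Delta).

(** The two values let the rank bound be used both without and with [s] adjoined. *)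
Definition secret_space (b : bool) : {vspace 'rV[F]_n} :=
  if b then <[s]>%VS else 0%VS.

Hypothesis wG : generic blk V secret_space w (enum P).

Local Notation block x := [set p | blk p == x].

Let V0 : V set0 = 0%VS.
Proof. by apply/eqP; rewrite -dimv_eq0 dimV (polymatroid_set0 hP). Qed.

Let VS (X Y : {set J}) : X \subset Y -> (V X <= V Y)%VS.
Proof. by move/setUidPr <-; rewrite VU addvSl. Qed.

Let wV p : w p \in V [set blk p].
Proof. by apply: (generic_mem wG); rewrite mem_enum. Qed.

Let sum_profile (A : {set P}) (Z : {set J}) :
  \sum_(x in Z) #|A :&: block x| = #|A :&: blocks blk Z|.
Proof.
rewrite -sum1_card (partition_big blk [in Z]) /=; last first.
  by move=> p; rewrite !inE => /andP[].
apply: eq_bigr => x xZ; rewrite -sum1_card; apply: eq_bigl => p.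
by rewrite !inE; case: eqP => [->|]; rewrite ?xZ ?andbT ?andbF.
Qed.

Lemma spanned_blocks (A : {set P}) (Y : {set J}) :
  A \subset blocks blk Y -> (spanned w A <= V Y)%VS.
Proof.
move=> sAY; apply/subv_sumP=> p pA; rewrite -memvE.
apply: (subvP (VS _) _ (wV p)).
by rewrite sub1set; have := subsetP sAY p pA; rewrite inE.
Qed.

(** The upper bound matching [generic_rank]: vectors in the blocks of [Y] stay in [V Y], and each
    other one adds at most one dimension. *)
Lemma dim_spanned_blocks (A : {set P}) (Y : {set J}) :
  \dim (spanned w A) <= h Y + #|A :\: blocks blk Y|.
Proof.
apply: leq_trans (_ : \dim (V Y + spanned w (A :\: blocks blk Y)) <= _).
  apply: dimvS; rewrite -{1}(setID A (blocks blk Y)).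
  apply: subv_trans (spannedU _ _ _) _.
  by rewrite addvS // spanned_blocks // subsetIr.
by rewrite (leq_trans (dim_addv_le _ _)) // dimV leq_add2l dim_spanned.
Qed.

(** If [w p] were zero, the rank bound for [[set p]] would give a [Y] of rank 0 containing the block
    of [p]. *)
Lemma generic_neq0 p : 0 < h [set blk p] -> w p != 0%R.
Proof.
move=> hp; apply: contraTneq (hp) => wp0.
have [|Y _] := generic_rank VU false set0 wG (_ : {subset [set p] <= enum P}).
  by move=> q; rewrite mem_enum.
rewrite V0 !add0v /spanned big_set1 wp0 dim_vline eqxx dimV leqn0 addn_eq0.
case/andP=> /eqP hY; rewrite cards_eq0 setD_eq0 sub1set inE => pY.
rewrite -leqNgt -hY; apply: (polymatroid_monotone hP).
by rewrite sub1set.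
Qed.

Lemma secret_spanned (Pi : J -> {set P}) A :
    (forall x, Pi x = block x) ->
  access_structure Pi h Delta A <-> s \in spanned w A.
Proof.
move=> PiE; have r_all (B : {set P}) : {subset B <= enum P}.
  by move=> p; rewrite mem_enum.
split=> [[v [[X XD [supp vX vY]] vA]]|sA].
  pose B := A :&: blocks blk X.
  have sB : B \subset blocks blk X by exact: subsetIr.
  have [Y _] := generic_rank VU false set0 wG (r_all B).
  rewrite V0 !add0v dimV => leY.
  suff spB : spanned w B = V X.
    apply: (subvP (spannedS _ (subsetIl _ _ : B \subset A))).
    by rewrite spB sV.
  apply/eqP; rewrite eqEdim spanned_blocks //= dimV (leq_trans _ leY) // -vX.
  (* The sum of [v] is split along [Y]: the part in [Y] is at most [h Y] by the basis inequalities,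
     the rest at most the number of participants of [B] outside the blocks of [Y]. *)
  have -> : \sum_x v x = \sum_(x in X) v x.
    rewrite [RHS]big_mkcond; apply: eq_bigr => x _; case: ifPn => // xX.
    by apply/eqP; apply: contraNT xX => vx; rewrite (subsetP supp) ?inE.
  rewrite (big_setID Y) leq_add //=.
    rewrite (leq_trans (vY _ (subsetIl _ _))) //.
    exact: (polymatroid_monotone hP (subsetIr _ _)).
  have -> : B :\: blocks blk Y = A :&: blocks blk (X :\: Y).
    by apply/setP=> p; rewrite !inE andbCA.
  rewrite -sum_profile leq_sum // => x _.
  by rewrite (leq_trans (vA x)) // ffunE PiE.
(* For an independent [B] spanning the same space, the lower rank bound with [s] and the upper one
   without it coincide at some [Y]; this yields both [s \in V Y] and [cBY]. *)
have [B [sBA spB dB]] := exists_independent w A.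
have [Y _] := generic_rank VU true set0 wG (r_all B).
have sB : (<[s]> <= spanned w B)%VS by rewrite -memvE spB.
rewrite V0 addv0 (addv_idPr sB) dB => leY.
have := dim_spanned_blocks B Y; rewrite dB => geY.
have dY : \dim (<[s]> + V Y) = \dim (V Y).
  apply/eqP; rewrite eqn_leq [X in _ && X]dimvS ?addvSr // andbT dimV.
  by rewrite -(leq_add2r #|B :\: blocks blk Y|) (leq_trans leY).
have sY : s \in V Y.
  have /eqP := dY; rewrite eq_sym (dimv_leqif_eq (addvSr _ _)) => /eqP ->.
  by rewrite memvE addvSl.
have cBY : #|B :&: blocks blk Y| = h Y.
  by move: leY; rewrite /= dY dimV; have := cardsID (blocks blk Y) B; lia.
(* The profile of [B] on [Y] is a basis vector of the polymatroid: its total is [cBY], and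
   independence of [B] bounds it on each [Z]. *)
exists [ffun x => if x \in Y then #|B :&: block x| else 0].
have sumE (Z : {set J}) : Z \subset Y ->
    \sum_(x in Z) [ffun x => if x \in Y then #|B :&: block x| else 0] x =
    #|B :&: blocks blk Z|.
  move=> sZY; rewrite -sum_profile; apply: eq_bigr => x xZ.
  by rewrite ffunE (subsetP sZY).
split=> [|x]; last first.
  rewrite !ffunE PiE; case: ifP => // _; exact/subset_leq_card/setSI.
exists Y; first by rewrite -sV.
split=> [||Z sZY].
- by apply/subsetP=> x; rewrite inE ffunE; case: ifP.
- rewrite -cBY -sumE // [RHS]big_mkcond; apply: eq_bigr => x _.
  by rewrite ffunE; case: ifP.
rewrite sumE // -(leq_add2r #|B :\: blocks blk Z|) cardsID -dB.
exact: dim_spanned_blocks.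
Qed.

End AccessStructure.

(** * Coordinate subspaces and indicator vectors *)

Section CoordinateSubspaces.

Local Open Scope ring_scope.
Variables (F : fieldType) (n : nat).
Implicit Types K T : {set 'I_n}.

Definition coordinate_space K : {vspace 'rV[F]_n} :=
  (\sum_(i in K) <[delta_mx 0%R i]>)%VS.

Lemma coordinate_spaceP K (v : 'rV[F]_n) :
  reflect (forall i, i \notin K -> v 0 i = 0) (v \in coordinate_space K).
Proof.
apply: (iffP memv_sumP) => [[vs vsK -> i iK]|v0].
  rewrite summxE big1 // => j jK; have /vlineP[c ->] := vsK j jK.
  by rewrite !mxE eqxx; case: eqP iK => [->|_ _]; rewrite ?jK // mulr0.
exists (fun i => v 0 i *: delta_mx 0 i) => [i _|].
  by rewrite memvZ ?memv_line.
rewrite {1}[v]row_sum_delta [LHS](bigID [in K]) /= [X in _ + X]big1 ?addr0 //.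
by move=> i /v0->; rewrite scale0r.
Qed.

Lemma coordinate_spaceU K T :
  coordinate_space (K :|: T) = (coordinate_space K + coordinate_space T)%VS.
Proof.
apply/eqP; rewrite eqEsubv subv_add; apply/and3P; split.
- apply/subv_sumP=> i; rewrite inE => /orP[iK|iT].
    exact: subv_trans (sumv_sup i iK (subvv _)) (addvSl _ _).
  exact: subv_trans (sumv_sup i iT (subvv _)) (addvSr _ _).
- by apply/subv_sumP=> i iK; apply: (sumv_sup i); rewrite ?inE ?iK.
- by apply/subv_sumP=> i iT; apply: (sumv_sup i); rewrite ?inE ?iT ?orbT.
Qed.

Lemma dim_coordinate_space K : \dim (coordinate_space K) = #|K|.
Proof.
move cK: #|K| => k; elim: k => [|k IHk] in K cK *.
  by rewrite (cards0_eq cK) /coordinate_space big_set0 dimv0.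
have [i iK] : exists i, i \in K by apply/card_gt0P; rewrite cK.
rewrite -(setD1K iK) /coordinate_space big_setU1 ?setD11 //=.
rewrite dim_add_vline ?IHk //; first by move: cK; rewrite (cardsD1 i) iK => -[].
apply/negP=> /coordinate_spaceP/(_ i); rewrite setD11 mxE !eqxx => /(_ isT)/eqP.
by rewrite oner_eq0.
Qed.

Lemma indicator_coordinate_space T K :
  ((\row_i (i \in T)%:R : 'rV[F]_n) \in coordinate_space K) = (T \subset K).
Proof.
apply/coordinate_spaceP/subsetP => [T0 i iT|sTK i iK].
  by apply: contraTT iT => /T0/eqP; rewrite mxE; case: (i \in T);
     rewrite ?oner_eq0.
by rewrite mxE (contraNF (sTK i) iK).
Qed.

End CoordinateSubspaces.

Theorem corollary5p4 (R : realType) (J : finType) (h : {set J} -> nat)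
    (g : nat -> nat) (hm : 3 <= #|J|) (hZ : uniform_polymatroid h g)
    (hg01 : g 1 <= g 0) (hg1 : g 1 = g #|J|.-1) (hgpos : 0 < g #|J|.-1)
    (P : finType) (Pi : J -> {set P}) (hPi : block_partition Pi)
    (hP : forall x : J, g 0 < #|Pi x|)
    (Delta : {set {set J}}) (hDelta : monotone_family Delta)
    (hcomp : compatible_family h Delta) :
  ideal_access_structure R (access_structure Pi h Delta).
Proof.
have hpoly := upoly_polymatroid hZ; have h0 := polymatroid_set0 hpoly.
have hE X := @uniform_flat_increments _ _ _ hZ X hg1.
have g1gt : 0 < g 1 <= g 0 by rewrite hg1 hgpos -hg1.
have [I [K [T [cK KU TK]]]] :=
  coordinate_representation hDelta hcomp h0 hE g1gt.
have [blk blkP] : exists blk : P -> J, forall p, p \in Pi (blk p).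
  apply: (@fin_all_exists P (fun=> J) (fun p x => p \in Pi x)) => p.
  have : p \in \bigcup_x Pi x by rewrite (ipart_cover hPi) inE.
  by case/bigcupP=> x _ px; exists x.
have PiE x : Pi x = [set p | blk p == x].
  apply/setP=> p; rewrite inE; apply/idP/eqP => [px|<- //].
  apply/eqP; apply: contraTT px => /(ipart_disjoint hPi)/disjointFr -> //.
(* The triples are those of [exists_generic], with [bool] indexing the two values of
   [secret_space]. *)
have [q ltq q_prime] := prime_above #|{: bool * {set J} * {set P}}|.
pose F : finFieldType := 'F_q.
pose V X := coordinate_space F (enum_rank @: K X).
have VU X Y : V (X :|: Y) = (V X + V Y)%VS.
  by rewrite /V KU imsetU coordinate_spaceU.
have dimV X : \dim (V X) = h X.
  by rewrite dim_coordinate_space card_imset ?cK //; exact: enum_rank_inj.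
pose s : 'rV[F]_#|I| := (\row_i (i \in enum_rank @: T)%:R)%R.
have sV X : (s \in V X) = (X \in Delta).
  rewrite indicator_coordinate_space -TK; apply/idP/idP; last exact: imsetS.
  move/subsetP=> sTK; apply/subsetP=> i iT.
  by have := sTK _ (imset_f _ iT); rewrite (mem_imset _ _ enum_rank_inj).
(* A zero [s] would lie in [V set0] and put the empty set in [Delta]. *)
have s0 : s != 0%R.
  apply: contraTneq (mfam_set0 hDelta) => s0.
  by rewrite -sV s0 mem0v.
have [|w wG] := @exists_generic F #|I| J P blk V _ (secret_space s) (enum P) _
  (enum_uniq P).
  by rewrite card_Fp.
have w0 p : w p != 0%R.
  apply: (generic_neq0 hpoly VU dimV wG).
  by rewrite hE ?cards1 ?muln0 ?addn0 ?(upoly_g0_gt0 hZ) // -card_gt0 cards1.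
exists (linear_scheme R s w); split=> //.
apply: linear_scheme_perfect => // A.
exact: (secret_spanned hpoly VU dimV sV wG).
Qed.
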